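(* Let $V$ be a finite-dimensional vector space over a field $\mathbf{k}$, let $f\in \mathbf{k}[V]$ be a homogeneous cubic polynomial of slice rank $2$ over $\mathbf{k}$, and let $X=(f=0)\subset\mathbb{P}V$. Then at least one of the following holds: - all linear subspaces $L\subset X$ with $\operatorname{codim}_{\mathbb{P}V}L=2$ are contained in a fixed hyperplane; or - $f$ is a pullback from a space of dimension at most $6$; or - $f$ can be written in the form $f=x_1y_1z_1+x_1y_2z_2+x_2y_1z_3$, where $x_1,x_2,y_1,y_2,z_1,z_2,z_3\in V^*$ are linearly independent; or - $f$ is a pullback from a space of dimension at most $8$ and $\operatorname{codim}_{\mathbb{P}V} L_f\le 4$; or - $f$ is a pullback from a space of dimension at most $9$ and $\operatorname{codim}_{\mathbb{P}V} L_f\le 3$. In all cases $\operatorname{codim}_{\mathbb{P}V} L_f\le 6$.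
   Context: The slice rank of a homogeneous polynomial $f$ over $\mathbf{k}$ is the minimal $r$ such that $f=l_1f_1+\ldots+l_rf_r$ with $l_i$ linear forms over $\mathbf{k}$; equivalently it is the minimal codimension in $\mathbb{P}V$ of a linear $\mathbf{k}$-subspace contained in the hypersurface $X=(f=0)$. All linear subspaces are defined over $\mathbf{k}$; they correspond to vector subspaces $U\subset V$, with $\operatorname{codim}_{\mathbb{P}V}\mathbb{P}U=\dim V-\dim U$ (also for $U=0$), and $\mathbb{P}U\subset X$ means that $f$ lies in the ideal generated by the linear forms vanishing on $U$. For $f$ of slice rank $r$ (here $r=2$), $$L_f:=\bigcap_{L\subset X,\ \operatorname{codim}_{\mathbb{P}V}L=r} L\subset\mathbb{P}V.$$ A polynomial $f\in\mathbf{k}[V]=S(V^* )$ is a pullback from a space of dimension $m$ if there is a linear subspace $W\subset V^*$ of dimension $m$ such that $f\in S(W)\subset S(V^* )$. *)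

(* Defs.v *)
From HB Require Import structures.
From mathcomp Require Import all_boot all_order all_algebra.
From mathcomp Require Import mpoly.
From Stdlib Require Import ClassicalEpsilon.

Set Implicit Arguments.
Unset Strict Implicit.
Unset Printing Implicit Defensive.

Import GRing.Theory.
Local Open Scope ring_scope.

(* k[V], the symmetric algebra of the dual of V, is the polynomial ring in
   \dim V variables, 'X_i standing for the i-th coordinate function on V with
   respect to the basis vbasis {:V}. *)
Notation "{ 'polyfun' k [ V ] }" := {mpoly k[\dim {: V%type}]}
  (at level 0, k at level 2, V at level 200,
   format "{ 'polyfun'  k [ V ] }").

Section Definitions.
Variables (k : fieldType) (V : vectType k).
Implicit Types (f : {polyfun k[V]}) (U L : {vspace V}).
Local Notation dualV := 'Hom(V, k^o).

(* The embedding of the dual of V in k[V]: phi is the sum of its values on the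
   basis vectors times the coordinate functions. *)
Definition lform (phi : dualV) : {polyfun k[V]} :=
  \sum_(i < \dim {:V}) (phi (tnth (vbasis {:V}) i) : k) *: 'X_i.

Definition slice_decomposable f (r : nat) : Prop :=
  exists (l : 'I_r -> dualV) (g : 'I_r -> {polyfun k[V]}),
    f = \sum_(i < r) lform (l i) * g i.

Definition has_slice_rank f (r : nat) : Prop :=
  slice_decomposable f r /\ forall s, slice_decomposable f s -> (r <= s)%N.

(* PU is contained in (f = 0) as schemes: f lies in the ideal generated by the
   linear forms vanishing on U. Over a finite field this is stronger than f
   vanishing at the k-points of U. *)
Definition sub_hypersurface U f : Prop :=
  exists (r : nat) (l : 'I_r -> dualV) (g : 'I_r -> {polyfun k[V]}),
    (forall i u, u \in U -> l i u = 0) /\ f = \sum_(i < r) lform (l i) * g i.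

(* The codimension of PU in PV, including U = 0. *)
Definition codimv U : nat := (\dim {:V} - \dim U)%N.

Lemma capv_family_exists (P : {vspace V} -> Prop) :
  exists M : {vspace V}, forall v, v \in M <-> forall U, P U -> v \in U.
Proof.
suff H n (M : {vspace V}) : (\dim M < n)%N ->
    (forall v, (forall U, P U -> v \in U) -> v \in M) ->
    exists M : {vspace V}, forall v, v \in M <-> forall U, P U -> v \in U.
  by apply: (H (\dim {:V}).+1 fullv) => // v _; rewrite memvf.
elim: n M => // n IHn M ltMn PM.
have [[U [PU nMU]]|nex] := classic (exists U, P U /\ ~~ (M <= U)%VS); last first.
  exists M => v; split=> [Mv U PU|]; last exact: PM.
  case: (boolP (M <= U)%VS) => [/subvP/(_ v Mv) //|nMU].
  by case: nex; exists U.
apply: (IHn (M :&: U)%VS) => [|v Pv]; last by rewrite memv_cap PM //= Pv.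
apply: leq_trans (ltMn : (\dim M <= n)%N); rewrite ltn_neqAle.
rewrite dimvS ?capvSl // andbT.
apply: contra nMU => /eqP eqd.
have /eqP <- : (M :&: U == M)%VS by rewrite eqEdim capvSl eqd leqnn.
exact: capvSr.
Qed.

Definition capv_family (P : {vspace V} -> Prop) : {vspace V} :=
  proj1_sig (constructive_indefinite_description _ (capv_family_exists P)).

Lemma memv_capv_family (P : {vspace V} -> Prop) v :
  v \in capv_family P <-> forall U, P U -> v \in U.
Proof. by rewrite /capv_family; case: constructive_indefinite_description. Qed.

(* The vector subspace whose projectivization is L_f, for f of slice rank r. *)
Definition Lspace f (r : nat) : {vspace V} :=
  capv_family (fun L => sub_hypersurface L f /\ codimv L = r).

(* f lies in S(W), the subalgebra of k[V] generated by W. *)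
Definition in_symalg (W : {vspace dualV}) f : Prop :=
  exists (N : nat) (l : N.-tuple dualV) (p : {mpoly k[N]}),
    {subset l <= W} /\ f = p \mPo [tuple lform (tnth l i) | i < N].

Definition is_pullback f (m : nat) : Prop :=
  exists W : {vspace dualV}, \dim W = m /\ in_symalg W f.

Definition is_pullback_atmost f (m : nat) : Prop :=
  exists2 d, (d <= m)%N & is_pullback f d.

End Definitions.

(* Main.v *)
(* A linear subspace L of codimension 2 in X is the zero locus of a plane P in
   V^* with f in the ideal (P); call such P a slice plane. Then L_f is cut out by
   the sum of all slice planes. Ideals generated by linear forms are prime, so
   membership of f in several of them can be resolved one factor at a time.

   If two slice planes <a1, a2>, <b1, b2> are disjoint, then
   f = a1 (b1 k1 + b2 k2) + a2 (b1 m1 + b2 m2). A third slice plane P outside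
   their sum either forces k1, k2, m1, m2 into a space of dimension at most 6
   together with the ai, bj, or meets one of the two planes, and then f has the
   normal form x1 y1 z1 + x1 y2 z2 + x2 y1 z3. If no two slice planes are
   disjoint, either they share a vector h, and modulo h the cubic f has at most
   three linear factors, or three of them are <a, b>, <b, c>, <c, a> and
   f = ab z1 + bc z2 + ca z3. The alternative with 9 variables never occurs.

   If f is in S(W), every slice plane P lies in W: a projection onto W killing a
   complement of the intersection of P and W in P fixes f and shows that f lies
   in the ideal of that intersection, so by minimality it is P. *)

Require Import Defs.
From HB Require Import structures.
From mathcomp Require Import all_boot all_order all_algebra.
From mathcomp Require Import mpoly.
From mathcomp Require Import ring.
From Stdlib Require Import Classical.

Set Implicit Arguments.
Unset Strict Implicit.
Unset Printing Implicit Defensive.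

Import GRing.Theory.
Local Open Scope ring_scope.

(** * Free families and planes in a vector space *)

Lemma free_sub_nth (K : fieldType) (vT : vectType K) (X : seq vT) (s : seq nat) :
  free X -> uniq s -> all (fun i => i < size X)%N s ->
  free [seq X`_i | i <- s].
Proof.
move=> fX us /allP s_lt.
pose s' := [seq i <- iota 0 (size X) | i \notin s].
have p : perm_eq (iota 0 (size X)) (s ++ s').
  apply: uniq_perm; rewrite ?iota_uniq //.
    rewrite cat_uniq us filter_uniq ?iota_uniq // andbT.
    by apply/hasPn => i; rewrite mem_filter => /andP[].
  move=> i; rewrite mem_cat mem_filter mem_iota add0n /=.
  by case: (boolP (i \in s)) => //= /s_lt ->.
have := perm_map (nth 0 X) p; rewrite map_cat => p'.
apply: (@catl_free _ _ [seq X`_i | i <- s']); rewrite -(perm_free p').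
by rewrite map_nth_iota0 // take_size.
Qed.

Lemma span2P (K : fieldType) (vT : vectType K) (a b v : vT) :
  v \in <<[:: a; b]>>%VS -> exists s t, v = s *: a + t *: b.
Proof.
rewrite span_cons span_seq1 => /memv_addP[_ /vlineP[s ->]].
by case=> _ /vlineP[t ->] ->; exists s, t.
Qed.

Lemma plane_extend (K : fieldType) (vT : vectType K) (P : {vspace vT}) v :
  \dim P = 2%N -> v \in P -> v != 0 ->
  exists u, P = <<[:: v; u]>>%VS /\ free [:: v; u].
Proof.
move=> dP vP v0.
have [u uP nu] : exists2 u, u \in P & u \notin <[v]>%VS.
  apply/subvPn; apply/negP => /dimvS; rewrite dP dim_vline; by case: (_ != _).
have fr : free [:: v; u].
  rewrite (@perm_free _ _ _ [:: u; v]) ?(perm_catC [:: v] [:: u]) //.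
  by rewrite free_cons span_seq1 nu seq1_free.
exists u; split=> //; apply/esym/eqP; rewrite eqEdim dP (eqnP fr) leqnn andbT.
by apply/span_subvP => x; rewrite !inE => /orP[] /eqP ->.
Qed.

Lemma plane_span (K : fieldType) (vT : vectType K) (P : {vspace vT}) u v :
  \dim P = 2%N -> u \in P -> v \in P -> free [:: u; v] ->
  P = <<[:: u; v]>>%VS.
Proof.
move=> dP uP vP fr; apply/esym/eqP; rewrite eqEdim dP (eqnP fr) leqnn andbT.
by apply/span_subvP => x; rewrite !inE => /orP[] /eqP ->.
Qed.

Lemma free_notin (K : fieldType) (vT : vectType K) (i : nat) (s : seq nat)
    (X : seq vT) : free X -> uniq (i :: s) -> all (gtn (size X)) (i :: s) ->
  X`_i \notin <<[seq X`_j | j <- s]>>%VS.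
Proof.
by move=> fX us sX; have := free_sub_nth fX us sX; rewrite free_cons => /andP[].
Qed.

Ltac sub_list :=
  let x := fresh in move=> x; rewrite !inE;
  by do ?[case/orP=> [/eqP ->|]]; rewrite ?eqxx ?orbT //;
     move/eqP ->; rewrite ?eqxx ?orbT.
Ltac in_span := by rewrite memv_span // !inE eqxx ?orbT.
Ltac sub_span := apply: sub_span; sub_list.
Ltac not_in i s fr := exact: (@free_notin _ _ i s _ fr isT isT).

Section Planes.
Variables (K : fieldType) (vT : vectType K).
Implicit Types (U W : {vspace vT}) (v : vT).

Lemma plane_basis U : \dim U = 2%N ->
  exists a b, U = <<[:: a; b]>>%VS /\ free [:: a; b].
Proof.
move=> dU; have U0 : vpick U != 0 by rewrite vpick0 -dimv_eq0 dU.
by have [b [E fr]] := plane_extend dU (memv_pick U) U0; exists (vpick U), b.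
Qed.

(** Two independent vectors in $U\cap W$ would span the plane $U$ and put it inside $W$. *)
Lemma plane_cap_line U W v v' : \dim U = 2%N -> ~~ (U <= W)%VS -> v != 0 ->
  v \in U -> v \in W -> v' \in U -> v' \in W -> v' \in <[v]>%VS.
Proof.
move=> dU nUW v0 vU vW v'U v'W; apply: contraR nUW => v'v.
have fr : free [:: v'; v] by rewrite free_cons span_seq1 v'v seq1_free.
rewrite (plane_span dU v'U vU fr).
by apply/span_subvP => x; rewrite !inE => /orP[] /eqP ->.
Qed.

(** If $v = sa + tb$, then $tb$ lies in $\langle a,c\rangle$ while $b$ does not, so $t = 0$. *)
Lemma cap_planes_line a b c v : free [:: b; a; c] ->
  v \in <<[:: a; b]>>%VS -> v \in <<[:: a; c]>>%VS -> v \in <[a]>%VS.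
Proof.
rewrite free_cons => /andP[bn _] /span2P[s [t ->]].
have aac : s *: a \in <<[:: a; c]>>%VS by apply: memvZ; in_span.
rewrite rpredDl // rpredZeq (negPf bn) orbF => /eqP ->.
by rewrite scale0r addr0 memvZ ?memv_line.
Qed.

Lemma daddv_pi_0 U W v : (U :&: W = 0)%VS -> v \in W -> daddv_pi U W v = 0.
Proof.
move=> UW vW; have := daddv_pi_add UW (subvP (addvSr U W) _ vW).
rewrite [daddv_pi W U v]daddv_pi_id 1?capvC // => E.
by apply: (addIr v); rewrite E add0r.
Qed.

End Planes.

(** * Ideals of $k[V]$ generated by spaces of linear forms *)

Section LinearIdeals.
Variables (k : fieldType) (V : vectType k).
Local Notation D := 'Hom(V, k^o).
Local Notation n := (\dim {: V}).
Local Notation R := {polyfun k[V]}.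
Implicit Types (f g : R) (P Q W : {vspace D}) (phi psi : 'End(D)) (l : D).

Lemma lform_is_linear : linear (@lform k V).
Proof.
move=> c l l'; rewrite /lform scaler_sumr -big_split /=; apply: eq_bigr => i _.
by rewrite add_lfunE scale_lfunE scalerDl scalerA.
Qed.

HB.instance Definition _ :=
  GRing.isLinear.Build k D R *:%R (@lform k V) lform_is_linear.

Lemma lformD l l' : lform (l + l') = lform l + lform l'.
Proof. exact: (linearD (@lform k V)). Qed.

Lemma lformN l : lform (- l) = - lform l.
Proof. exact: (linearN (@lform k V)). Qed.

Lemma lformZ c l : lform (c *: l) = c%:MP * lform l.
Proof. by rewrite linearZ mul_mpolyC. Qed.

Definition lformE := (lformD, lformN, lformZ).

Definition coordf (i : 'I_n) : D :=
  linfun (coord (vbasis {:V}) i : V -> k^o).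

Lemma lfun_coordf l : l = \sum_i (l (tnth (vbasis {:V}) i) : k) *: coordf i.
Proof.
apply/lfunP => v; rewrite sum_lfunE.
rewrite {1}(coord_vbasis (memvf v)) linear_sum; apply: eq_bigr => i _.
by rewrite linearZ scale_lfunE lfunE /= (tnth_nth 0) /GRing.scale /= mulrC.
Qed.

Lemma lform_coordf i : lform (coordf i) = 'X_i.
Proof.
rewrite /lform (bigD1 i) //= big1 => [|j ji]; rewrite lfunE /= (tnth_nth 0).
  by rewrite coord_free ?(basis_free (vbasisP _)) // eqxx scale1r addr0.
by rewrite coord_free ?(basis_free (vbasisP _)) // (negPf ji) scale0r.
Qed.

Lemma lform_eq0 l : lform l = 0 -> l = 0.
Proof.
move=> l0; rewrite (lfun_coordf l); apply: big1 => i _.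
have /(congr1 (mcoeff U_(i))) := l0; rewrite mcoeff0 linear_sum /=.
rewrite (bigD1 i) //= big1 => [|j ji]; rewrite mcoeffZ mcoeffX.
  by rewrite eqxx mulr1 addr0 => ->; rewrite scale0r.
by rewrite eq_mnm1 (negPf ji) mulr0.
Qed.

Lemma lform_homog l : lform l \is 1.-homog.
Proof.
by apply: rpred_sum => i _; apply: rpredZ; rewrite dhomogX /= mdeg1.
Qed.

Lemma homog_ind (T : R -> Prop) (d : nat) :
  T 0 -> (forall g g', T g -> T g' -> T (g + g')) ->
  (forall c g, T g -> T (c *: g)) ->
  (forall m, mdeg m = d -> T 'X_[m]) ->
  forall g, g \is d.-homog -> T g.
Proof.
move=> T0 TD TZ TX g /dhomogP hg; rewrite (mpolyE g) big_seq.
apply: (big_ind T) => // m mg; apply/TZ/TX; exact: hg.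
Qed.

Lemma homog1_lform g : g \is 1.-homog -> exists l, g = lform l.
Proof.
elim/homog_ind => {g}.
- by exists 0; rewrite linear0.
- by move=> _ _ [l ->] [l' ->]; exists (l + l'); rewrite linearD.
- by move=> c _ [l ->]; exists (c *: l); rewrite linearZ.
move=> m /eqP/mdeg1P[i /eqP ->]; exists (coordf i); by rewrite lform_coordf.
Qed.

Lemma homog0_const g : g \is 0.-homog -> exists c, g = c%:MP.
Proof.
elim/homog_ind => {g}.
- by exists 0.
- by move=> _ _ [l ->] [l' ->]; exists (l + l'); rewrite mpolyCD.
- by move=> c _ [l ->]; exists (c * l); rewrite mpolyCM mul_mpolyC.
by move=> m /eqP; rewrite mdeg_eq0 => /eqP ->; exists 1; rewrite mpolyX0.
Qed.

(** This is $S(\varphi)$, the ring endomorphism of the symmetric algebra induced by [phi] through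
    functoriality. *)
Definition lsub phi : R -> R :=
  comp_mpoly [tuple lform (phi (coordf i)) | i < n].

HB.instance Definition _ phi := GRing.Linear.on (lsub phi).
HB.instance Definition _ phi := GRing.RMorphism.on (lsub phi).

Lemma lsub_lform phi l : lsub phi (lform l) = lform (phi l).
Proof.
rewrite {1}/lform {2}(lfun_coordf l) !linear_sum /=; apply: eq_bigr => i _.
rewrite !linearZ /=; congr (_ *: _).
by rewrite /lsub comp_mpolyXU -tnth_nth tnth_mktuple.
Qed.

Lemma lsub_comp phi psi g : lsub phi (lsub psi g) = lsub (phi \o psi)%VF g.
Proof.
rewrite (mpolyE g) [lsub psi _]linear_sum !linear_sum /=; apply: eq_bigr => m _.
rewrite !linearZ /=; congr (_ *: _); rewrite /lsub !comp_mpolyX rmorph_prod /=.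
apply: eq_bigr => i _; rewrite rmorphXn /= !tnth_mktuple comp_lfunE.
by congr (_ ^+ _); apply: lsub_lform.
Qed.

Lemma lsub_lform_id W l : l \in W -> lsub (projv W) (lform l) = lform l.
Proof. by move=> lW; rewrite lsub_lform projv_id. Qed.

Lemma lsubD_id phi f g :
  lsub phi f = f -> lsub phi g = g -> lsub phi (f + g) = f + g.
Proof. by rewrite [lsub phi (f + g)]rmorphD => {2}<- {2}<-. Qed.

Lemma lsubM_id phi f g :
  lsub phi f = f -> lsub phi g = g -> lsub phi (f * g) = f * g.
Proof. by rewrite [lsub phi (f * g)]rmorphM => {2}<- {2}<-. Qed.

Lemma lsub1 g : lsub \1%VF g = g.
Proof.
rewrite -[RHS]comp_mpoly_id; congr (_ \mPo _).
by apply/eq_from_tnth => i; rewrite !tnth_mktuple id_lfunE lform_coordf.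
Qed.

(* Reduction modulo the ideal generated by the linear forms in P. That ideal is
   the kernel of an endomorphism of the domain k[V], hence is prime. *)
Definition modid P : R -> R := lsub (\1 - projv P)%VF.

HB.instance Definition _ P := GRing.Linear.on (modid P).
HB.instance Definition _ P := GRing.RMorphism.on (modid P).

Lemma modidD P f g : modid P (f + g) = modid P f + modid P g.
Proof. exact: (rmorphD (modid P)). Qed.

Lemma modidN P f : modid P (- f) = - modid P f.
Proof. exact: (rmorphN (modid P)). Qed.

Lemma modidM P f g : modid P (f * g) = modid P f * modid P g.
Proof. exact: (rmorphM (modid P)). Qed.

Definition modidE := (modidD, modidN, modidM).

Definition inid P f : Prop := modid P f = 0.

Lemma modid_lform P l : modid P (lform l) = lform (l - projv P l).
Proof. by rewrite /modid lsub_lform add_lfunE opp_lfunE id_lfunE. Qed.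

Lemma inid_lform P l : inid P (lform l) <-> l \in P.
Proof.
rewrite /inid modid_lform; split=> [/lform_eq0/eqP|/projv_id ->].
  by rewrite subr_eq0 => /eqP ->; apply: memv_proj.
by rewrite subrr linear0.
Qed.

Lemma modid_lform0 P l : l \in P -> modid P (lform l) = 0.
Proof. by move/inid_lform. Qed.

(** Since [phi] kills [P], composing it with [\1 - projv P] does not change it; so $S(\varphi)$
    factors through reduction modulo [P]. *)
Lemma modid_lsub P phi g :
  (forall l, l \in P -> phi l = 0) -> lsub phi (modid P g) = lsub phi g.
Proof.
move=> phi0; rewrite lsub_comp; congr (lsub _ g); apply/lfunP => l.
rewrite comp_lfunE add_lfunE opp_lfunE id_lfunE linearB /=.
by rewrite (phi0 (projv P l)) ?subr0 ?memv_proj.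
Qed.

(** Reduction modulo [Q] comes from a map that kills [Q], hence [P], so it factors through reduction
    modulo [P]. *)
Lemma inidS P Q g : (P <= Q)%VS -> inid P g -> inid Q g.
Proof.
move=> sPQ Pg; rewrite /inid /modid -(modid_lsub (P := P)).
  by rewrite [modid P g]Pg linear0.
move=> l /(subvP sPQ) lQ.
by rewrite add_lfunE opp_lfunE id_lfunE projv_id // subrr.
Qed.

Lemma inid0 g : inid 0%VS g -> g = 0.
Proof.
rewrite /inid /modid => <-; rewrite -{1}(lsub1 g); congr (lsub _ _).
apply/lfunP => l; rewrite add_lfunE opp_lfunE id_lfunE.
by have := memv_proj 0 l; rewrite memv0 => /eqP ->; rewrite subr0.
Qed.

Lemma inidD P f g : inid P f -> inid P g -> inid P (f + g).
Proof. by rewrite /inid rmorphD /= => -> ->; rewrite addr0. Qed.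

Lemma inidMl P f g : inid P g -> inid P (f * g).
Proof. by rewrite /inid rmorphM /= => ->; rewrite mulr0. Qed.

Lemma inid_prime P l g : l \notin P -> inid P (lform l * g) -> inid P g.
Proof.
move=> lP; rewrite /inid rmorphM /= => /eqP; rewrite mulf_eq0.
by case/orP => /eqP // /inid_lform lP'; rewrite lP' in lP.
Qed.

(** One generator is split off with a homogeneous cofactor. For every homogeneous [g], the
    difference between [g] and its reduction modulo $(a, P)$ is a multiple of [a] modulo [P]; this
    claim is linear in [g], so monomials suffice. *)
Lemma inid_add_line P a d g : g \is d.+1.-homog -> inid (<[a]> + P)%VS g ->
  exists2 h, h \is d.-homog & inid P (g - lform a * h).
Proof.
move=> hg; rewrite /inid => g0.
suff [h hh] : exists2 h, h \is d.-homog &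
    inid P (g - modid (<[a]> + P) g - lform a * h).
  by rewrite g0 subr0; exists h.
elim/homog_ind: hg => {g g0}.
- by exists 0; rewrite ?dhomog0 // /inid rmorph0 mulr0 !subr0 rmorph0.
- move=> g g' [h hh gh] [h' hh' gh']; exists (h + h'); first by rewrite rpredD.
  rewrite (_ : _ - _ = g - modid (<[a]> + P) g - lform a * h +
    (g' - modid (<[a]> + P) g' - lform a * h')); last by rewrite rmorphD /=; ring.
  exact: inidD.
- move=> c g [h hh gh]; exists (c *: h); first by rewrite rpredZ.
  rewrite linearZ /= -scalerAr -!scalerBr /inid linearZ /= [modid _ _]gh.
  by rewrite scaler0.
(* A Leibniz rule for one more variable: if $x_i = ca + p + r$ with $r$ the reduction of $x_i$, and
   $m - \bar m \equiv ah$, then $x_i m - r\bar m \equiv a(cm + rh)$ modulo [P]. Homogeneity of [h]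
   is expressed through the products [lform j * h] so that the induction can start at [e = 0] with
   [h = 0]. *)
have step e m i : mdeg m = e ->
    (exists2 h, (forall j, lform j * h \is e.-homog) &
       inid P ('X_[m] - modid (<[a]> + P) 'X_[m] - lform a * h)) ->
    exists2 h, h \is e.-homog & inid P ('X_[U_(i) + m] -
      modid (<[a]> + P) 'X_[U_(i) + m] - lform a * h).
  move=> hm [h hh mh].
  have : projv (<[a]> + P) (coordf i) \in (<[a]> + P)%VS by apply: memv_proj.
  case/memv_addP => _ /vlineP[c ->] [p pP E].
  exists (c *: 'X_[m] + lform (coordf i - (c *: a + p)) * h).
    by rewrite rpredD ?rpredZ // dhomogX /= hm.
  rewrite mpolyXD -lform_coordf rmorphM /= modid_lform E.
  rewrite !linearB linearD linearZ /=.
  set A := lform a; set C := lform (coordf i).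
  rewrite -!mul_mpolyC.
  rewrite (_ : _ - _ = 'X_[m] * lform p + (C - (c%:MP * A + lform p)) *
    ('X_[m] - modid (<[a]> + P) 'X_[m] - A * h)); last by ring.
  by apply: inidD; apply: inidMl => //; apply/inid_lform.
elim: d => [|d IHd] m.
  move/eqP/mdeg1P => [i /eqP ->]; rewrite -[U_(i)%MM]addm0.
  apply: step; first exact: mdeg0.
  exists 0; first by move=> j; rewrite mulr0 dhomog0.
  by rewrite mpolyX0 /inid mulr0 !subr0 !rmorph1 subrr rmorph0.
move=> hm; have [i mi] : exists i, m i != 0%N.
  apply/existsP; apply: contra_eqT hm; rewrite negb_exists => /forallP m0.
  by rewrite mdegE big1 // => i _; have := m0 i; rewrite negbK => /eqP.
have E : m = (U_(i) + (m - U_(i)))%MM.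
  by rewrite addmC submK //; apply/mnm_lepP => j; rewrite mnm1E;
     case: eqP => // <-; rewrite lt0n.
have hm' : mdeg (m - U_(i)) = d.+1.
  by move: hm; rewrite {1}E mdegD mdeg1 add1n => -[].
rewrite E; apply: step => //; have [h hh mh] := IHd _ hm'.
by exists h => // j; rewrite -add1n; apply: dhomogM => //; exact: lform_homog.
Qed.
End LinearIdeals.

(* Abstracting the atoms stops [ring] from pushing its morphisms through them,
   which is slow. *)
Ltac ring_forms :=
  repeat match goal with
  | |- context [modid ?P ?g] => generalize (modid P g); intro
  end;
  repeat match goal with
  | |- context [lform ?l] => generalize (lform l); intro
  end; ring.

Ltac mod0 x := rewrite (modid_lform0 (l := x)); last by in_span.

(** * Expressions of a cubic forced by the planes whose ideals contain it *)

Section Decompositions.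
Variables (k : fieldType) (V : vectType k).
Local Notation D := 'Hom(V, k^o).
Local Notation n := (\dim {: V}).
Local Notation R := {polyfun k[V]}.
Implicit Types (f g : R) (P Q W : {vspace D}) (phi psi : 'End(D)) (l : D).

Lemma inid_cons a X d g : g \is d.+1.-homog -> inid <<a :: X>> g ->
  exists2 h, h \is d.-homog & inid <<X>> (g - lform a * h).
Proof. by rewrite span_cons; apply: inid_add_line. Qed.

Lemma homog_lformM d l g : g \is d.-homog -> lform l * g \is d.+1.-homog.
Proof. by move=> hg; rewrite -add1n; apply: dhomogM => //; apply: lform_homog. Qed.

Lemma inid_line a d g : g \is d.+1.-homog -> inid <[a]> g ->
  exists2 h, h \is d.-homog & g = lform a * h.
Proof.
move=> hg; rewrite -[<[a]>%VS]addv0 => /(inid_add_line hg)[h hh /inid0/eqP].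
by rewrite subr_eq0 => /eqP; exists h.
Qed.

Lemma inid_pair a b d g : g \is d.+1.-homog -> inid <<[:: a; b]>> g ->
  exists h h', [/\ h \is d.-homog, h' \is d.-homog &
                   g = lform a * h + lform b * h'].
Proof.
move=> hg /(inid_cons hg)[h hh]; rewrite span_seq1.
have hg' : g - lform a * h \is d.+1.-homog by rewrite rpredB // homog_lformM.
move/(inid_line hg') => [h' hh' E]; exists h, h'; split=> //.
by rewrite -E addrC subrK.
Qed.

Lemma span_consP a X l : l \in <<a :: X>>%VS ->
  exists s p, p \in <<X>>%VS /\ l = s *: a + p.
Proof.
by rewrite span_cons => /memv_addP[_ /vlineP[s ->] [p pX ->]]; exists s, p.
Qed.

(** Used with [Q] chosen so that all terms of [f] but one vanish modulo [Q]; primality then applies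
    to the remaining product. *)
Lemma inid_modE P Q f g : (P <= Q)%VS -> modid Q f = modid Q g ->
  inid P f -> inid Q g.
Proof. by move=> sPQ E /(inidS sPQ); rewrite /inid E. Qed.

Lemma inid_prime2 P x y z : x \notin P -> y \notin P ->
  inid P (lform x * (lform y * lform z)) -> z \in P.
Proof. by move=> xP yP /(inid_prime xP)/(inid_prime yP)/inid_lform. Qed.

Section TwoDisjointPlanes.
Variables (f : R) (a1 a2 b1 b2 : D).
Hypothesis f3 : f \is 3.-homog.

(** Write $f = a_1h_1 + a_2h_2$. Modulo $a_1, b_1, b_2$ only $a_2h_2$ is left, so $h_2 \equiv a_1p$
    modulo the $b_j$. Moving $a_1p$ from $h_2$ to $h_1$ as $a_2p$ puts both cofactors into $(b_1,
    b_2)$. *)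
Lemma two_planes : free [:: a1; a2; b1; b2] ->
  inid <<[:: a1; a2]>> f -> inid <<[:: b1; b2]>> f ->
  exists k1 k2 m1 m2, f = lform a1 * (lform b1 * lform k1 + lform b2 * lform k2)
    + lform a2 * (lform b1 * lform m1 + lform b2 * lform m2).
Proof.
move=> fr /(inid_pair f3)[h1 [h2 [hh1 hh2 E]]] fb.
have a1n : a1 \notin <<[:: b1; b2]>>%VS by not_in 0%N [:: 2; 3]%N fr.
have a2n : a2 \notin <<[:: a1; b1; b2]>>%VS by not_in 1%N [:: 0; 2; 3]%N fr.
have : inid <<[:: a1; b1; b2]>> (lform a2 * h2).
  apply: inid_modE fb; first by sub_span.
  by rewrite E !modidE; mod0 a1; rewrite mul0r add0r.
move/(inid_prime a2n)/(inid_cons hh2) => [p hp h2p].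
have : inid <<[:: b1; b2]>> (lform a1 * (h1 + lform a2 * p)).
  apply: inid_modE fb => //.
  rewrite (_ : f = lform a1 * (h1 + lform a2 * p) + lform a2 * (h2 - lform a1 * p)).
    by rewrite modidD [X in _ + X]modidM [modid _ (_ - _)]h2p mulr0 addr0.
  by rewrite E; ring_forms.
move/(inid_prime a1n)/inid_pair => /(_ 1%N).
case; first by rewrite rpredD // homog_lformM.
move=> _ [_ [/homog1_lform[k1 ->] /homog1_lform[k2 ->] E1]].
case/(inid_pair (d := 1)) : h2p; first by rewrite rpredB // homog_lformM.
move=> _ [_ [/homog1_lform[m1 ->] /homog1_lform[m2 ->] E2]].
exists k1, k2, m1, m2; rewrite -E1 -E2 E; ring_forms.
Qed.

Variables (k1 k2 m1 m2 : D).
Hypothesis Ef : f = lform a1 * (lform b1 * lform k1 + lform b2 * lform k2)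
    + lform a2 * (lform b1 * lform m1 + lform b2 * lform m2).

Lemma two_planes_lsub W :
  {subset [:: a1; a2; b1; b2; k1; k2; m1; m2] <= W} -> lsub (projv W) f = f.
Proof.
move=> sW; rewrite Ef; do ![apply: lsubD_id|apply: lsubM_id];
  by apply/lsub_lform_id/sW; rewrite !inE eqxx ?orbT.
Qed.

(** Modulo $c_1, c_2$, one $a_i$ and one $b_j$, the cubic becomes a single product of three forms.
    Two of them are nonzero there, so the third must vanish. *)
Lemma disjoint_third_plane c1 c2 : free [:: a1; a2; b1; b2; c1; c2] ->
  inid <<[:: c1; c2]>> f ->
  {subset [:: k1; k2; m1; m2] <= <<[:: a1; a2; b1; b2; c1; c2]>>%VS}.
Proof.
move=> fr fc.
have H X x y z : {subset [:: c1; c2] <= X} ->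
    {subset X <= [:: a1; a2; b1; b2; c1; c2]} ->
    x \notin <<X>>%VS -> y \notin <<X>>%VS ->
    modid <<X>> f = modid <<X>> (lform x * (lform y * lform z)) ->
    z \in <<[:: a1; a2; b1; b2; c1; c2]>>%VS.
  move=> cX X6 xX yX E; apply: (subvP (sub_span X6)).
  by apply: (inid_prime2 xX yX); apply: inid_modE E fc; apply: sub_span.
move=> z; rewrite !inE => /or4P[] /eqP ->.
- apply: (H [:: c1; c2; a2; b2] a1 b1); [sub_list|sub_list| | | ].
  + not_in 0%N [:: 4; 5; 1; 3]%N fr.
  + not_in 2%N [:: 4; 5; 1; 3]%N fr.
  by rewrite Ef !modidE; mod0 a2; mod0 b2; ring_forms.
- apply: (H [:: c1; c2; a2; b1] a1 b2); [sub_list|sub_list| | | ].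
  + not_in 0%N [:: 4; 5; 1; 2]%N fr.
  + not_in 3%N [:: 4; 5; 1; 2]%N fr.
  by rewrite Ef !modidE; mod0 a2; mod0 b1; ring_forms.
- apply: (H [:: c1; c2; a1; b2] a2 b1); [sub_list|sub_list| | | ].
  + not_in 1%N [:: 4; 5; 0; 3]%N fr.
  + not_in 2%N [:: 4; 5; 0; 3]%N fr.
  by rewrite Ef !modidE; mod0 a1; mod0 b2; ring_forms.
- apply: (H [:: c1; c2; a1; b1] a2 b2); [sub_list|sub_list| | | ].
  + not_in 1%N [:: 4; 5; 0; 2]%N fr.
  + not_in 3%N [:: 4; 5; 0; 2]%N fr.
  by rewrite Ef !modidE; mod0 a1; mod0 b1; ring_forms.
Qed.

(** Here the third plane meets the sum of the other two in a vector of neither. Modulo [v] the form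
    $b_1$ becomes $-a_1$, so modulo $a_1, v, w$ only $a_2b_2m_2$ survives, which locates $m_2$. *)
Lemma diagonal_third_plane (v w : D) : v = a1 + b1 ->
  free [:: a1; a2; v; b2; w] -> inid <<[:: v; w]>> f ->
  {subset [:: k1; k2; m1; m2] <= <<[:: a1; a2; v; b2; w]>>%VS}.
Proof.
move=> Ev fr fv.
have Eb1 : lform b1 = lform v - lform a1 by rewrite Ev linearD addrC addKr.
have m2a : m2 \in <<[:: a1; v; w]>>%VS.
  apply: (@inid_prime2 _ a2 b2).
  - not_in 1%N [:: 0; 2; 4]%N fr.
  - not_in 3%N [:: 0; 2; 4]%N fr.
  apply: inid_modE fv; first by sub_span.
  rewrite Ef Eb1 !modidE; mod0 v; mod0 a1; ring_forms.
have [c [p [pvw Em2]]] := span_consP m2a.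
(* Substituting $m_2 = ca_1 + p$ with $p \in \langle v, w\rangle$ makes $a_1$ a factor of $f$ modulo
   $v, w$. The cofactor is this quadric, whose terms are then isolated one at a time. *)
have fq : inid <<[:: v; w]>> (lform b2 * lform k2 - lform a1 * lform k1
    - lform a2 * lform m1 + lform (c *: a2) * lform b2).
  apply: (@inid_prime _ _ _ a1); first by not_in 0%N [:: 2; 4]%N fr.
  apply: inid_modE fv => //.
  rewrite Ef Eb1 Em2 lformD !lformZ.
  rewrite !modidE (modid_lform0 pvw); mod0 v; ring_forms.
have H X x z : {subset [:: v; w] <= X} ->
    {subset X <= [:: a1; a2; v; b2; w]} -> x \notin <<X>>%VS ->
    modid <<X>> (lform b2 * lform k2 - lform a1 * lform k1
      - lform a2 * lform m1 + lform (c *: a2) * lform b2) =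
    modid <<X>> (lform x * lform z) ->
    z \in <<[:: a1; a2; v; b2; w]>>%VS.
  move=> vX X5 xX E; apply: (subvP (sub_span X5)); apply/inid_lform.
  by apply: (inid_prime xX); apply: inid_modE E fq; apply: sub_span.
move=> z; rewrite !inE => /or4P[] /eqP ->.
- apply: (H [:: v; w; a2; b2] (- a1)); [sub_list|sub_list| | ].
  + by rewrite memvN; not_in 0%N [:: 2; 4; 1; 3]%N fr.
  rewrite lformN lformZ !modidE.
  mod0 a2; mod0 b2; ring_forms.
- apply: (H [:: v; w; a2; a1] b2); [sub_list|sub_list| | ].
  + not_in 3%N [:: 2; 4; 1; 0]%N fr.
  rewrite lformZ !modidE.
  mod0 a2; mod0 a1; ring_forms.
- apply: (H [:: v; w; a1; b2] (- a2)); [sub_list|sub_list| | ].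
  + by rewrite memvN; not_in 1%N [:: 2; 4; 0; 3]%N fr.
  rewrite lformN lformZ !modidE.
  mod0 a1; mod0 b2; ring_forms.
by apply: (subvP _ _ m2a); sub_span.
Qed.

(** Modulo $a_1, w$ the form $a_2$ cancels, so $b_1m_1 + b_2m_2$ lies in $(a_1, w)$. Hence, modulo
    $a_1, w$, the pair $(m_1, m_2)$ is a multiple of $(-b_2, b_1)$, which contributes nothing to
    $f$. *)
Lemma adjacent_third_plane w : free [:: a1; a2; b1; b2; w] ->
  inid <<[:: a1; w]>> f ->
  exists x1 x2 y1 y2 z1 z2 z3, f = lform x1 * lform y1 * lform z1
    + lform x1 * lform y2 * lform z2 + lform x2 * lform y1 * lform z3.
Proof.
move=> fr fw.
have m2a : m2 \in <<[:: b1; a1; w]>>%VS.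
  apply: (@inid_prime2 _ a2 b2).
  - not_in 1%N [:: 2; 0; 4]%N fr.
  - not_in 3%N [:: 2; 0; 4]%N fr.
  apply: inid_modE fw; first by sub_span.
  rewrite Ef !modidE; mod0 a1; mod0 b1; ring_forms.
have [t [p [pw Em2]]] := span_consP m2a.
have : m1 + t *: b2 \in <<[:: a1; w]>>%VS.
  apply: (@inid_prime2 _ a2 b1).
  - not_in 1%N [:: 0; 4]%N fr.
  - not_in 2%N [:: 0; 4]%N fr.
  apply: inid_modE fw => //.
  rewrite Ef Em2 !lformE !modidE.
  rewrite (modid_lform0 pw); mod0 a1; ring_forms.
case/span2P=> [al [ga Em1]]; have [al' [ga' Ep]] := span2P pw.
have {}Em1 : m1 = al *: a1 + ga *: w - t *: b2 by rewrite -Em1 addrK.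
(* Now $f = a_1(b_1k_1' + b_2k_2') + a_2w(\gamma b_1 + \gamma' b_2)$. So [y1] is $b_1 +
   (\gamma'/\gamma)b_2$ if $\gamma \neq 0$ and $b_2$ otherwise, the remaining scalar going into
   [z3]. *)
have [ga0|ga0] := eqVneq ga 0; last first.
  pose c := ga' / ga.
  exists a1, a2, (b1 + c *: b2), b2, (k1 + al *: a2),
    (k2 + al' *: a2 - c *: (k1 + al *: a2)), (ga *: w).
  have Ega : ga' = c * ga by rewrite divfK.
  rewrite Ef Em2 Em1 Ep Ega !lformE mpolyCM; ring_forms.
exists a1, a2, b2, b1, (k2 + al' *: a2), (k1 + al *: a2), (ga' *: w).
rewrite Ef Em2 Em1 Ep ga0 !lformE mpolyC0; ring_forms.
Qed.

End TwoDisjointPlanes.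

(** In $f = ag_1 + bg_2$, reduction modulo $b, c$ gives $g_1 = bn_1 + cz_3$. The term $abn_1$ is
    absorbed into the cofactor of $b$, which reduction modulo $c, a$ then resolves. *)
Lemma triangle f a b c : f \is 3.-homog -> free [:: a; b; c] ->
  inid <<[:: a; b]>> f -> inid <<[:: b; c]>> f -> inid <<[:: c; a]>> f ->
  exists z1 z2 z3, f = lform a * lform b * lform z1
    + lform b * lform c * lform z2 + lform c * lform a * lform z3.
Proof.
move=> f3 fr /(inid_pair f3)[g1 [g2 [hg1 hg2 E]]] fbc fca.
have : inid <<[:: b; c]>> g1.
  apply: (@inid_prime _ _ _ a); first by not_in 0%N [:: 1; 2]%N fr.
  apply: inid_modE fbc => //.
  by rewrite E !modidE; mod0 b; ring_forms.
case/(inid_pair hg1) => _ [_ [/homog1_lform[n1 ->] /homog1_lform[z3 ->] E1]].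
have : inid <<[:: c; a]>> (g2 + lform a * lform n1).
  apply: (@inid_prime _ _ _ b); first by not_in 1%N [:: 2; 0]%N fr.
  apply: inid_modE fca => //.
  by rewrite E E1 !modidE; mod0 a; mod0 c; ring_forms.
case/(inid_pair (d := 1)); first by rewrite rpredD // homog_lformM ?lform_homog.
move=> _ [_ [/homog1_lform[z2 ->] /homog1_lform[z1 ->] E2]].
exists z1, z2, z3; rewrite E E1.
rewrite (_ : g2 = lform c * lform z2 + lform a * lform z1 - lform a * lform n1).
  by ring_forms.
by rewrite -E2 addrK.
Qed.

(* Modulo h, the d + 1 elements of s are pairwise coprime divisors of g. *)
Lemma planes_through_line h (s : seq D) d g : g \is d.-homog ->
  size s = d.+1 -> free (h :: s) ->
  (forall a, a \in s -> inid <<[:: a; h]>> g) -> inid <[h]> g.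
Proof.
elim: s d g => // a s IHs [|d] g hg; rewrite /= => -[szs] fr gs.
  have [c cE] := homog0_const hg; have := gs a (mem_head _ _).
  rewrite /inid cE -alg_mpolyC !linearZ /= !rmorph1 alg_mpolyC => /eqP.
  by rewrite mpolyC_eq0 => /eqP ->; rewrite mpolyC0.
have fr' : free (a :: h :: s).
  by rewrite (@perm_free _ _ _ (h :: a :: s)) //
     -[_ :: _ :: s]cat1s (perm_catCA [:: a] [:: h]).
have := gs a (mem_head _ _).
move/(inid_cons hg); rewrite span_seq1 => -[g1 hg1 gg1].
(* Modulo [h], every other [b] in [s] divides $ag_1$ but not $a$, hence divides $g_1$, whose degree
   is one less. *)
have g1h : inid <[h]> g1.
  have frs : free (h :: s) by move: fr'; rewrite free_cons => /andP[].
  apply: (IHs d g1 hg1 szs frs) => b bs.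
  apply: (@inid_prime _ _ _ a).
    move: fr'; rewrite free_cons => /andP[+ _]; apply: contra; apply: subvP.
    by apply: sub_span => x; rewrite !inE => /orP[] /eqP ->; rewrite ?bs ?eqxx ?orbT.
  rewrite -[_ * _](subKr g); apply: inidD.
    by apply: gs; rewrite inE bs orbT.
  rewrite /inid modidN (inidS _ gg1) ?oppr0 //.
  by rewrite -span_seq1; sub_span.
by rewrite -[g](subrK (lform a * g1)); apply: inidD => //; apply: inidMl.
Qed.

(** A polynomial fixed by the substitution equals its own value at the projections of the coordinate
    functions, and these lie in [W]. *)
Lemma in_symalg_lsub W g : lsub (projv W) g = g -> in_symalg W g.
Proof.
move=> E; exists n, [tuple projv W (coordf i) | i < n], g; split.
  by move=> l /tnthP[i ->]; rewrite tnth_mktuple memv_proj.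
rewrite -{1}E; congr (_ \mPo _).
by apply/eq_from_tnth => i; rewrite !tnth_mktuple.
Qed.

Lemma lsub_in_symalg W phi g :
  (forall l, l \in W -> phi l = l) -> in_symalg W g -> lsub phi g = g.
Proof.
move=> phiW [N [s [p [sW ->]]]]; rewrite comp_mpolyEX linear_sum /=.
apply: eq_bigr => m _; rewrite !linearZ /=; congr (_ *: _).
rewrite !comp_mpolyX rmorph_prod /=; apply: eq_bigr => i _.
by rewrite rmorphXn /= tnth_mktuple lsub_lform phiW // sW // mem_tnth.
Qed.

Lemma is_pullback_span (X : seq D) m f : (size X <= m)%N ->
  lsub (projv <<X>>) f = f -> is_pullback_atmost f m.
Proof.
move=> Xm fX; exists (\dim <<X>>); first exact: leq_trans (dim_span _) Xm.
by exists <<X>>%VS; split=> //; apply: in_symalg_lsub.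
Qed.

End Decompositions.

(** * Annihilators and common zeros of linear forms *)

Section DualSpaces.
Variables (k : fieldType) (V : vectType k).
Local Notation D := 'Hom(V, k^o).

(** The coordinates of a complement [C] of [L], composed with the projection onto [C] along [L],
    span the annihilator; they vanish together exactly where that projection does, on [L]. *)
Lemma annihilator_exists (L : {vspace V}) : exists P : {vspace D},
  [/\ (\dim P <= codimv L)%N,
      forall l : D, (forall v, v \in L -> l v = 0) <-> l \in P &
      forall v, (forall l : D, l \in P -> l v = 0) -> v \in L].
Proof.
pose C := (L^C)%VS; pose pi := daddv_pi C L.
have CL : (C :&: L = 0)%VS by rewrite capvC capv_compl.
have CLv v : v \in (C + L)%VS by rewrite addvC addv_complf memvf.
pose a (i : 'I_(\dim C)) : D :=
  (linfun (coord (vbasis C) i : V -> k^o) \o pi)%VF.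
have aE i v : a i v = coord (vbasis C) i (pi v).
  by rewrite comp_lfunE lfunE.
have piE v : pi v = \sum_(i < \dim C) a i v *: (vbasis C)`_i.
  rewrite {1}(coord_vbasis (memv_pi C L v)).
  by apply: eq_bigr => i _; rewrite aE.
exists <<[tuple a i | i < \dim C]>>%VS; split.
- apply: leq_trans (dim_span _) _; rewrite size_tuple /codimv.
  by rewrite dimv_compl.
- move=> l; split=> [lL|/coord_span -> v vL]; last first.
    rewrite sum_lfunE big1 // => i _; rewrite scale_lfunE nth_mktuple aE.
    by rewrite /pi daddv_pi_0 // linear0 scaler0.
  have -> : l = \sum_(i < \dim C) (l ((vbasis C)`_i) : k) *: a i.
    apply/lfunP => v; rewrite sum_lfunE.
    rewrite -{1}(daddv_pi_add CL (CLv v)) linearD /= (lL _ (memv_pi _ _ _)).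
    rewrite addr0 -/(pi v) piE linear_sum; apply: eq_bigr => i _.
    by rewrite linearZ scale_lfunE /GRing.scale /= mulrC.
  apply: memv_suml => i _; apply: memvZ; apply: memv_span.
  by rewrite map_f ?mem_enum.
move=> v v0; rewrite -(daddv_pi_add CL (CLv v)) -/(pi v) piE big1 => [|i _].
  by rewrite add0r memv_pi.
by rewrite v0 ?scale0r //; apply: memv_span; rewrite map_f ?mem_enum.
Qed.

Lemma common_zeros (X : seq D) : exists U : {vspace V},
  (\dim {:V} <= \dim U + size X)%N /\
  forall v l, v \in U -> l \in <<X>>%VS -> l v = 0.
Proof.
elim: X => [|l X [U [dU UX]]].
  exists fullv; split; first by rewrite addn0.
  by move=> v l _; rewrite span_nil memv0 => /eqP ->; rewrite zero_lfunE.
exists (U :&: lker l)%VS; split.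
  rewrite (leq_trans dU) // addnS -addSn leq_add2r -(limg_ker_dim l U) -addn1.
  by rewrite leq_add2l (leq_trans (dimvS (subvf _))) // dimvf.
move=> v l'; rewrite memv_cap => /andP[vU /[!memv_ker]/eqP lv].
case/span_consP => s [p [pX ->]].
by rewrite add_lfunE scale_lfunE lv (UX _ _ vU pX) scaler0 addr0.
Qed.

Lemma codimv_lker (h : D) : h != 0 -> codimv (lker h) = 1%N.
Proof.
move=> h0; have := limg_ker_dim h fullv; rewrite capfv /codimv => <-.
rewrite addKn; apply/eqP; rewrite eqn_leq; apply/andP; split.
  by rewrite (leq_trans (dimvS (subvf _))) // dimvf.
by rewrite lt0n dimv_eq0 -lkerE; apply: contra h0 => /subvP hk;
  apply/eqP/lfunP => v; have := hk v (memvf v); rewrite memv_ker zero_lfunE => /eqP.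
Qed.

End DualSpaces.

(** * Slice planes of a cubic of slice rank 2 *)

Section SliceRankTwo.
Variables (k : fieldType) (V : vectType k).
Local Notation D := 'Hom(V, k^o).
Local Notation n := (\dim {: V}).
Variable f : {polyfun k[V]}.
Hypotheses (f3 : f \is 3.-homog) (f_slice : has_slice_rank f 2).
Implicit Types (P Q W : {vspace D}).

Lemma slice_line a : ~ inid <[a]> f.
Proof.
move=> /(inid_line f3)[h _ E]; have [_ /(_ 1%N)] := f_slice.
have f1 : slice_decomposable f 1.
  by exists (fun _ => a), (fun _ => h); rewrite big_ord1.
by move/(_ f1).
Qed.

Definition slice_plane P := \dim P = 2%N /\ inid P f.

Lemma slice_dim P : inid P f -> (\dim P <= 2)%N -> slice_plane P.
Proof.
move=> Pf dP; split=> //; apply/eqP; rewrite eqn_leq dP ltnNge /=.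
(* A space of dimension at most 1 lies in the span of [vpick P], which slice rank 2 rules out. *)
apply/negP => dP1; apply: (@slice_line (vpick P)).
apply: inidS Pf; apply/subvP => v vP.
have [P0|P0] := eqVneq P 0%VS.
  by move: vP; rewrite P0 memv0 => /eqP ->; rewrite mem0v.
have -> : (<[vpick P]> = P)%VS; last by [].
apply/eqP; rewrite eqEdim -memvE memv_pick dim_vline vpick0 P0 /=.
exact: dP1.
Qed.

Lemma exists_slice_plane : exists P, slice_plane P.
Proof.
have [[l [g E]] _] := f_slice.
exists <<[:: l ord0; l ord_max]>>%VS; apply: slice_dim; last exact: dim_span.
rewrite E /inid big_ord_recl big_ord1 rmorphD !rmorphM /=.
rewrite modid_lform0; last by in_span.
rewrite modid_lform0 ?mul0r ?addr0 //.
have -> : lift ord0 ord0 = ord_max :> 'I_2 by apply/val_inj.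
by in_span.
Qed.

Lemma slice_plane_pullback W P : in_symalg W f -> slice_plane P -> (P <= W)%VS.
Proof.
move=> fW [dP Pf].
pose T := (P :\: W)%VS; pose Q := (P :&: W)%VS.
have WT : (W :&: T = 0)%VS.
  by apply/eqP; rewrite -subv0 -(capv_diff P W) -/T capvC capvS // capvC.
pose phi := daddv_pi W T.
(* As [phi] kills [T] and fixes [Q], following it by reduction modulo [Q] kills $P = T + Q$. Since
   [phi] fixes [f], the reduction of [f] modulo [Q] factors through that modulo [P]. *)
have Qf : inid Q f.
  rewrite /inid -(lsub_in_symalg (phi := phi) _ fW); last first.
    by move=> l lW; rewrite /phi daddv_pi_id.
  rewrite /modid lsub_comp -(modid_lsub (P := P)); last first.
    move=> l; rewrite -(addv_diff_cap P W) => /memv_addP[t tT [q qQ ->]].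
    rewrite comp_lfunE linearD /= daddv_pi_0 // add0r.
    rewrite daddv_pi_id //; last by move: qQ; rewrite memv_cap => /andP[].
    by rewrite add_lfunE opp_lfunE id_lfunE projv_id ?subrr.
  by rewrite [modid P f]Pf linear0.
have [dQ _] := slice_dim Qf (leq_trans (dimvS (capvSl _ _)) (eq_leq dP)).
have /eqP <- : Q == P by rewrite eqEdim capvSl dQ dP.
exact: capvSr.
Qed.

(** The common zeros of [W] have codimension at most $\dim W$. They lie in every [L] of the
    intersection, because the annihilator of [L] is a slice plane and so is inside [W]. *)
Lemma Lspace_codim_le W m : (\dim W <= m)%N ->
  (forall P, slice_plane P -> (P <= W)%VS) -> (codimv (Lspace f 2) <= m)%N.
Proof.
move=> dW PW; have [U [dU U0]] := common_zeros (vbasis W).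
rewrite size_tuple in dU; rewrite (span_basis (vbasisP W)) in U0.
rewrite /codimv leq_subLR (leq_trans dU) // leq_add // dimvS //.
apply/subvP => v vU.
apply/memv_capv_family => L [[r [l [g [lL fE]]]] cL].
have [P [dP lP]] := annihilator_exists L; apply=> l' l'P; apply: (U0 _ _ vU).
rewrite cL in dP; apply: (subvP (PW P _)) l'P; apply: slice_dim => //.
rewrite fE /inid rmorph_sum /=; apply: big1 => i _.
by rewrite modidM modid_lform0 ?mul0r //; apply/lP/lL.
Qed.

Lemma slice_plane_of L : sub_hypersurface L f -> codimv L = 2%N ->
  exists2 P, slice_plane P & forall l v, l \in P -> v \in L -> l v = 0.
Proof.
move=> [r [l [g [lL fE]]]] cL; have [P [dP lP _]] := annihilator_exists L.
exists P; last by move=> l' v /lP; apply.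
rewrite cL in dP; apply: slice_dim => //.
rewrite fE /inid rmorph_sum /=; apply: big1 => i _.
by rewrite modidM modid_lform0 ?mul0r //; apply/lP/lL.
Qed.

Lemma pullback6_bound :
  is_pullback_atmost f 6 -> (codimv (Lspace f 2) <= 6)%N.
Proof.
move=> [d d6 [W [dW fW]]]; apply: (Lspace_codim_le (W := W)).
  by rewrite dW.
by move=> P; apply: slice_plane_pullback.
Qed.

(** A slice plane outside the span of [h] and [s] adds a new element to [s]. The list stops at
    length three at most, so a space of dimension 4 contains all slice planes. *)
Lemma common_line_bound h : h != 0 ->
  (forall P, slice_plane P -> h \in P) -> (codimv (Lspace f 2) <= 4)%N.
Proof.
move=> h0 hP.
suff [W dW PW] : exists2 W, (\dim W <= 4)%N & forall P, slice_plane P -> (P <= W)%VS.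
  exact: Lspace_codim_le PW.
have H m : (exists2 W, (\dim W <= m)%N & forall P, slice_plane P -> (P <= W)%VS)
    \/ exists s, [/\ size s = m, free (h :: s) &
         forall a, a \in s -> inid <<[:: a; h]>> f].
  elim: m => [|m [[W dW PW]|[s [sm frs fs]]]].
  - by right; exists [::]; rewrite seq1_free.
  - by left; exists W => //; apply: leqW.
  have [PW|nPW] := classic (forall P, slice_plane P -> (P <= <<h :: s>>)%VS).
    by left; exists <<h :: s>>%VS => //; rewrite -sm; apply: dim_span.
  right; have {nPW}[P [Ps /negP nP]] : exists P, slice_plane P /\ ~ (P <= <<h :: s>>)%VS.
    by apply: NNPP => nex; apply: nPW => P Ps; apply: NNPP => nP; case: nex; exists P.
  have [dP Pf] := Ps; have [a [EP fra]] := plane_extend dP (hP _ Ps) h0.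
  exists (a :: s); split; first by rewrite /= sm.
    rewrite (@perm_free _ _ _ (a :: h :: s)).
      rewrite free_cons frs andbT; apply: contra nP => as_; rewrite EP.
      apply/span_subvP => x; rewrite !inE => /orP[] /eqP -> //.
      by apply: memv_span; apply: mem_head.
    by rewrite -[_ :: _ :: _]cat1s (perm_catCA [:: h] [:: a]).
  move=> b; rewrite inE => /orP[/eqP ->|/fs //].
  by apply: inidS Pf; rewrite EP; sub_span.
(* Four linear factors independent modulo [h] exceed the degree of [f], so they would force [f] into
   the ideal of [h]. *)
have [//|[s [s4 fr fs]]] := H 4.
by case: (slice_line (planes_through_line f3 s4 fr fs)).
Qed.

Lemma disjoint_planes_free (a1 a2 b1 b2 : D) : free [:: a1; a2] ->
  free [:: b1; b2] -> (<<[:: a1; a2]>> :&: <<[:: b1; b2]>> = 0)%VS ->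
  free [:: a1; a2; b1; b2].
Proof.
move=> fa fb ab; rewrite -[_ :: _]/([:: a1; a2] ++ [:: b1; b2]) cat_free fa fb.
exact/directv_addP.
Qed.

(** If [P3] meets the sum trivially, six forms suffice. Otherwise it contains some $v = a_1 + b_1$:
    when one summand is zero, [v] lies in [P1] or [P2]; when both are nonzero, five forms
    suffice. *)
Lemma third_plane P1 P2 P3 : slice_plane P1 -> slice_plane P2 ->
  slice_plane P3 -> (P1 :&: P2 = 0)%VS -> ~~ (P3 <= P1 + P2)%VS ->
  is_pullback_atmost f 6 \/
  exists2 v, v != 0 & v \in P3 /\ (v \in P1 \/ v \in P2).
Proof.
move=> [d1 f1] [d2 f2] [d3 f3'] cap12 nP3.
have [cap3|cap3] := eqVneq ((P1 + P2) :&: P3)%VS 0%VS.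
  have [a1 [a2 [E1 fra]]] := plane_basis d1.
  have [b1 [b2 [E2 frb]]] := plane_basis d2.
  have [c1 [c2 [E3 frc]]] := plane_basis d3; subst P1 P2 P3.
  have fr := disjoint_planes_free fra frb cap12.
  have [k1 [k2 [m1 [m2 Ef]]]] := two_planes f3 fr f1 f2.
  have fr6 : free [:: a1; a2; b1; b2; c1; c2].
    rewrite -[_ :: _]/([:: a1; a2; b1; b2] ++ [:: c1; c2]) cat_free fr frc.
    by apply/directv_addP; rewrite -[[:: a1; _; _; _]]/([:: a1; a2] ++ [:: b1; b2]) span_cat.
  have sk := disjoint_third_plane Ef fr6 f3'.
  left; apply: (@is_pullback_span _ _ [:: a1; a2; b1; b2; c1; c2]) => //.
  apply: (two_planes_lsub Ef) => x.
  rewrite -[[:: a1; a2; b1; b2; k1; _; _; _]]/([:: a1; a2; b1; b2] ++ [:: k1; k2; m1; m2]).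
  rewrite mem_cat => /orP[|/sk //] xa; apply: memv_span.
  by rewrite -[[:: a1; a2; b1; b2; c1; _]]/([:: a1; a2; b1; b2] ++ [:: c1; c2]) mem_cat xa.
set v := vpick ((P1 + P2) :&: P3)%VS.
have v0 : v != 0 by rewrite vpick0.
have /andP[v12 v3] : (v \in (P1 + P2)%VS) && (v \in P3).
  by rewrite -memv_cap memv_pick.
have /memv_addP[a1 a1P [b1 b1P Ev]] := v12.
have [b10|b10] := eqVneq b1 0.
  by right; exists v => //; split=> //; left; rewrite Ev b10 addr0.
have [a10|a10] := eqVneq a1 0.
  by right; exists v => //; split=> //; right; rewrite Ev a10 add0r.
have [a2 [E1 fra]] := plane_extend d1 a1P a10.
have [b2 [E2 frb]] := plane_extend d2 b1P b10.
have [w [E3 frc]] := plane_extend d3 v3 v0.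
have wn : w \notin (P1 + P2)%VS.
  apply: contra nP3 => w12; rewrite E3.
  by apply/span_subvP => x; rewrite !inE => /orP[] /eqP ->.
rewrite {}E1 {}E2 in f1 f2 cap12 wn.
have fr := disjoint_planes_free fra frb cap12.
have [k1 [k2 [m1 [m2 Ef]]]] := two_planes f3 fr f1 f2.
have frv : free [:: a1; a2; v; b2; w].
  have E : free [:: a1; a2; v; b2; w] = free [:: w; v; a1; a2; b2].
    apply: perm_free; apply/permP => p /=; ring_forms.
  rewrite E free_cons free_cons; apply/and3P; split.
  - apply: contra wn; apply: subvP; apply/span_subvP => x.
    have E12 : (<<[:: a1; a2]>> + <<[:: b1; b2]>>)%VS = <<[:: a1; a2; b1; b2]>>%VS.
      by rewrite -span_cat.
    rewrite !inE => /or4P[] /eqP ->; rewrite E12; last 3 first.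
    - by in_span.
    - by in_span.
    - by in_span.
    by rewrite Ev rpredD //; in_span.
  - rewrite Ev rpredDl; last by in_span.
    by not_in 2%N [:: 0; 1; 3]%N fr.
  exact: (free_sub_nth (s := [:: 0; 1; 3]%N) fr).
have sk := diagonal_third_plane Ef Ev frv (eq_ind _ (fun P => inid P f) f3' _ E3).
left; apply: (@is_pullback_span _ _ [:: a1; a2; v; b2; w]) => //.
apply: (two_planes_lsub Ef) => x.
rewrite -[[:: a1; a2; b1; b2; k1; _; _; _]]/([:: a1; a2; b1; b2] ++ [:: k1; k2; m1; m2]).
rewrite mem_cat => /orP[|/sk //]; rewrite !inE => /or4P[] /eqP ->; try by in_span.
by rewrite -[b1](addKr a1) -Ev addrC rpredB //; in_span.
Qed.

(** The shared vector [v] serves as $a_1$, and the second generator of [P3] is independent of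
    [P1 + P2]. *)
Lemma adjacent_plane P1 P2 P3 v : slice_plane P1 -> slice_plane P2 ->
  slice_plane P3 -> (P1 :&: P2 = 0)%VS -> ~~ (P3 <= P1 + P2)%VS ->
  v != 0 -> v \in P3 -> v \in P1 ->
  exists x1 x2 y1 y2 z1 z2 z3, f = lform x1 * lform y1 * lform z1
    + lform x1 * lform y2 * lform z2 + lform x2 * lform y1 * lform z3.
Proof.
move=> [d1 f1] [d2 f2] [d3 f3'] cap12 nP3 v0 v3 v1.
have [a2 [E1 fra]] := plane_extend d1 v1 v0.
have [b1 [b2 [E2 frb]]] := plane_basis d2.
have [w [E3 frc]] := plane_extend d3 v3 v0.
have wn : w \notin (P1 + P2)%VS.
  apply: contra nP3 => w12; rewrite E3.
  apply/span_subvP => x; rewrite !inE => /orP[] /eqP -> //.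
  by apply: (subvP (addvSl _ _)).
subst P1 P2 P3.
have fr := disjoint_planes_free fra frb cap12.
have [k1 [k2 [m1 [m2 Ef]]]] := two_planes f3 fr f1 f2.
apply: (adjacent_third_plane Ef _ f3').
rewrite (@perm_free _ _ _ ([:: w] ++ [:: v; a2; b1; b2])); last first.
  exact: (permEl (perm_catC [:: v; a2; b1; b2] [:: w])).
by rewrite free_cons fr andbT -[_ :: _]/([:: v; a2] ++ [:: b1; b2]) span_cat.
Qed.

(** As [P] meets [W] only in the line of [x], none of [p], [q], [r] lies in [P]; yet their product
    lies in the prime ideal of [P]. *)
Lemma no_residual_plane P W x p q r : slice_plane P -> ~~ (P <= W)%VS ->
  x != 0 -> x \in P -> x \in W ->
  {subset [:: p; q; r] <= W} -> {in [:: p; q; r], forall y, y \notin <[x]>%VS} ->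
  modid P f = modid P (lform p * (lform q * lform r)) -> False.
Proof.
move=> [dP Pf] nPW x0 xP xW sW nx E.
have nP y : y \in [:: p; q; r] -> y \notin P.
  move=> yl; apply: contra (nx _ yl) => yP.
  exact: (plane_cap_line dP nPW x0 xP xW yP (sW _ yl)).
have rP : r \in P.
  apply: (@inid_prime2 _ _ _ p q); last by rewrite /inid -E.
    by apply: nP; rewrite !inE eqxx.
  by apply: nP; rewrite !inE eqxx orbT.
by have := nP r; rewrite !inE eqxx !orbT rP => /(_ isT).
Qed.

(** * Slice planes of the seven-variable normal form *)

Section NormalForm.
Variables (x1 x2 y1 y2 z1 z2 z3 : D).
Hypothesis fr : free [:: x1; x2; y1; y2; z1; z2; z3].
Hypothesis Ef : f = lform x1 * lform y1 * lform z1
    + lform x1 * lform y2 * lform z2 + lform x2 * lform y1 * lform z3.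

(* Comparing P with the disjoint pairs <x1, x2>, <y1, y2> and <x1, z3>, <y1, z2>
   of slice planes forces x1 or y1 into P. *)
Lemma normal_form_planes P : ~ is_pullback_atmost f 6 -> slice_plane P ->
  (P <= <<[:: x1; x2; y1; y2; z2; z3]>>)%VS.
Proof.
move=> n6 Ps; apply: contraT => nP; exfalso; have [dP Pf] := Ps.
set W := <<_>>%VS in nP.
have sW (s : seq D) : {subset s <= [:: x1; x2; y1; y2; z2; z3]} -> {subset s <= W}.
  by move=> ss x xs; apply: memv_span; apply: ss.
have plane (a b : D) : free [:: a; b] -> modid <<[:: a; b]>> f = 0 -> slice_plane <<[:: a; b]>>.
  by move=> fab fm; split=> //; apply/eqP.
have pA : slice_plane <<[:: x1; x2]>>.
  apply: plane; [exact: (free_sub_nth (s := [:: 0; 1]%N) fr)|].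
  by rewrite Ef !modidE; mod0 x1; mod0 x2; ring_forms.
have pA' : slice_plane <<[:: x1; z3]>>.
  apply: plane; [exact: (free_sub_nth (s := [:: 0; 6]%N) fr)|].
  by rewrite Ef !modidE; mod0 x1; mod0 z3; ring_forms.
have pB : slice_plane <<[:: y1; y2]>>.
  apply: plane; [exact: (free_sub_nth (s := [:: 2; 3]%N) fr)|].
  by rewrite Ef !modidE; mod0 y1; mod0 y2; ring_forms.
have pB' : slice_plane <<[:: y1; z2]>>.
  apply: plane; [exact: (free_sub_nth (s := [:: 2; 5]%N) fr)|].
  by rewrite Ef !modidE; mod0 y1; mod0 z2; ring_forms.
have cap (a b c d : D) : free ([:: a; b] ++ [:: c; d]) ->
    (<<[:: a; b]>> :&: <<[:: c; d]>> = 0)%VS.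
  by rewrite cat_free => /and3P[_ _ /directv_addP].
have get (a b c d : D) : {subset [:: a; b; c; d] <= [:: x1; x2; y1; y2; z2; z3]} ->
    free [:: a; b; c; d] -> slice_plane <<[:: a; b]>> ->
    slice_plane <<[:: c; d]>> ->
    exists v, [/\ v != 0, v \in P, v \in W &
      v \in <<[:: a; b]>>%VS \/ v \in <<[:: c; d]>>%VS].
  move=> ss frs pab pcd.
  have sab : (<<[:: a; b; c; d]>> <= W)%VS by apply/span_subvP/sW.
  have sE : (<<[:: a; b]>> + <<[:: c; d]>> = <<[:: a; b; c; d]>>)%VS.
    by rewrite -span_cat.
  have [|//|[v v0 [vP vab]]] := third_plane pab pcd Ps (cap _ _ _ _ frs).
    by rewrite sE; apply: contra nP => /subv_trans; apply.
  exists v; split=> //; apply: (subvP sab); rewrite -sE.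
  by case: vab; apply: subvP; rewrite ?addvSl ?addvSr.
have [| | | |v [v0 vP vW vAB]] := @get x1 x2 y1 y2; first by sub_list.
- exact: (free_sub_nth (s := [:: 0; 1; 2; 3]%N) fr).
- exact: pA.
- exact: pB.
have [| | | |v' [v'0 v'P v'W vAB']] := @get x1 z3 y1 z2; first by sub_list.
- exact: (free_sub_nth (s := [:: 0; 6; 2; 5]%N) fr).
- exact: pA'.
- exact: pB'.
(* Since [P] is not inside [W], their intersection is a line, so [v] and [v'] are proportional and
   [v] inherits both alternatives. *)
have {vAB'} vAB' : v \in <<[:: x1; z3]>>%VS \/ v \in <<[:: y1; z2]>>%VS.
  have /vlineP[c ->] := plane_cap_line dP nP v'0 v'P v'W vP vW.
  by case: vAB' => h; [left|right]; apply: memvZ.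
have lineP (x : D) : x != 0 -> v \in <[x]>%VS -> x \in P.
  move=> x0 /vlineP[c Ec]; move: vP v0; rewrite Ec rpredZeq scaler_eq0.
  by case: (c == 0).
have neq0 (x : D) : x \in [:: x1; x2; y1; y2; z1; z2; z3] -> x != 0 by apply: free_not0.
(* In the mixed cases [v] lies in two disjoint planes. In the others it spans the line of [x1] or
   [y1], modulo which [f] is the single product $x_2y_1z_3$ or $x_1y_2z_2$ of forms in [W]. *)
case: vAB => [vA|vB]; case: vAB' => [vA'|vB'].
- have x10 : x1 != 0 by apply: neq0; rewrite mem_head.
  have vx : v \in <[x1]>%VS.
    by apply: cap_planes_line vA vA'; exact: (free_sub_nth (s := [:: 1; 0; 6]%N) fr).
  have x1P := lineP _ x10 vx.
  apply: (@no_residual_plane P W x1 x2 y1 z3) => //.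
  + by apply: (sW [:: x1]) (mem_head _ _); sub_list.
  + by apply: sW; sub_list.
  + move=> y; rewrite -span_seq1 !inE => /or3P[] /eqP ->.
    * not_in 1%N [:: 0]%N fr.
    * not_in 2%N [:: 0]%N fr.
    * not_in 6%N [:: 0]%N fr.
  by rewrite Ef !modidE (modid_lform0 x1P); ring_forms.
- have /eqP := cap _ _ _ _ (free_sub_nth (s := [:: 0; 1; 2; 5]%N) fr isT isT).
  rewrite -subv0 => /subvP/(_ v); rewrite memv_cap vA vB' memv0 => /(_ isT).
  exact/negP.
- have /eqP := cap _ _ _ _ (free_sub_nth (s := [:: 0; 6; 2; 3]%N) fr isT isT).
  rewrite -subv0 => /subvP/(_ v); rewrite memv_cap vA' vB memv0 => /(_ isT).
  exact/negP.
have y10 : y1 != 0 by apply: neq0; rewrite !inE eqxx !orbT.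
have vy : v \in <[y1]>%VS.
  by apply: cap_planes_line vB vB'; exact: (free_sub_nth (s := [:: 3; 2; 5]%N) fr).
have y1P := lineP _ y10 vy.
apply: (@no_residual_plane P W y1 x1 y2 z2) => //.
+ by apply: (sW [:: y1]) (mem_head _ _); sub_list.
+ by apply: sW; sub_list.
+ move=> y; rewrite -span_seq1 !inE => /or3P[] /eqP ->.
  * not_in 0%N [:: 2]%N fr.
  * not_in 3%N [:: 2]%N fr.
  * not_in 5%N [:: 2]%N fr.
by rewrite Ef !modidE (modid_lform0 y1P); ring_forms.
Qed.

End NormalForm.

Lemma normal_form_pullback (x1 x2 y1 y2 z1 z2 z3 : D) :
  f = lform x1 * lform y1 * lform z1 + lform x1 * lform y2 * lform z2
    + lform x2 * lform y1 * lform z3 ->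
  ~ free [:: x1; x2; y1; y2; z1; z2; z3] -> is_pullback_atmost f 6.
Proof.
move=> Ef /negP nfr; exists (\dim <<[:: x1; x2; y1; y2; z1; z2; z3]>>).
  have := dim_span [:: x1; x2; y1; y2; z1; z2; z3].
  by rewrite leq_eqVlt; move: nfr; rewrite /free => /negPf ->.
exists <<[:: x1; x2; y1; y2; z1; z2; z3]>>%VS; split=> //; apply: in_symalg_lsub.
by rewrite Ef; do ![apply: lsubD_id|apply: lsubM_id];
  apply: lsub_lform_id; in_span.
Qed.

(** Without a common vector, three slice planes meet pairwise in independent lines, and the triangle
    form needs only six linear forms. *)
Lemma meeting_planes :
  (forall P Q, slice_plane P -> slice_plane Q -> (P :&: Q)%VS != 0%VS) ->
  (exists2 h, h != 0 & forall P, slice_plane P -> h \in P) \/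
  is_pullback_atmost f 6.
Proof.
move=> meet.
have [//|nh] := classic (exists2 h, h != 0 & forall P, slice_plane P -> h \in P).
  by left.
have avoid h : h != 0 -> exists2 P, slice_plane P & h \notin P.
  move=> h0; apply: NNPP => nP; apply: nh; exists h => // P Ps.
  by apply: contraT => hP; case: nP; exists P.
have pick P Q : slice_plane P -> slice_plane Q ->
    exists v, [/\ v != 0, v \in P & v \in Q].
  move=> Ps Qs; exists (vpick (P :&: Q)%VS); rewrite vpick0 meet //.
  have := memv_pick (P :&: Q)%VS; rewrite memv_cap => /andP[-> ->]; by split.
have [P1 P1s] := exists_slice_plane.
(* This only supplies a nonzero vector of [P1]; a slice plane [P2] avoiding it differs from [P1]. *)
have [a0 [a00 a0P _]] := pick _ _ P1s P1s.
have [P2 P2s a0P2] := avoid _ a00.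
have [h [h0 h1 h2]] := pick _ _ P1s P2s.
have [P3 P3s hP3] := avoid _ h0.
have [u [u0 u1 u3]] := pick _ _ P1s P3s.
have [u' [u'0 u'2 u'3]] := pick _ _ P2s P3s.
have hu x : x != 0 -> x \in P3 -> free [:: h; x].
  move=> x0 x3; rewrite free_cons span_seq1 seq1_free x0 andbT.
  by apply: contra hP3 => /vlineP[c ->]; apply: memvZ.
have [d1 f1] := P1s; have [d2 f2] := P2s; have [d3 f3'] := P3s.
have E1 := plane_span d1 h1 u1 (hu _ u0 u3).
have E2 := plane_span d2 h2 u'2 (hu _ u'0 u'3).
(* Otherwise [h] and [u'] would span both [P1] and [P2], against the choice of [a0]. *)
have u'1 : u' \notin P1.
  apply: contra a0P2 => u'1.
  by rewrite E2 -(plane_span d1 h1 u'1 (hu _ u'0 u'3)).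
have fr : free [:: u'; h; u] by rewrite free_cons hu // andbT -E1.
have E3 : P3 = <<[:: u; u']>>%VS.
  by apply: plane_span => //; exact: (free_sub_nth (s := [:: 2; 0]%N) fr).
have [| | | |z1 [z2 [z3 Ef]]] := @triangle _ _ f h u u' f3.
- exact: (free_sub_nth (s := [:: 1; 2; 0]%N) fr).
- by rewrite -E1.
- by rewrite -E3.
- by rewrite (_ : <<_>>%VS = P2) // E2; apply/eqP; rewrite eqEsubv; apply/andP; split; sub_span.
right; apply: (@is_pullback_span _ _ [:: h; u; u'; z1; z2; z3]) => //.
by rewrite Ef; do ![apply: lsubD_id|apply: lsubM_id];
  apply: lsub_lform_id; in_span.
Qed.

End SliceRankTwo.

(** * Assembly of the cases *)

Theorem theorem3p6 (k : fieldType) (V : vectType k) (f : {polyfun k[V]})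
    (f_cubic : f \is 3.-homog) (f_slice : has_slice_rank f 2) :
  ( (exists H : {vspace V}, codimv H = 1%N /\
        forall L : {vspace V},
          sub_hypersurface L f -> codimv L = 2%N -> (L <= H)%VS)
    \/ is_pullback_atmost f 6
    \/ (exists x1 x2 y1 y2 z1 z2 z3 : 'Hom(V, k^o),
          free [:: x1; x2; y1; y2; z1; z2; z3] /\
          f = lform x1 * lform y1 * lform z1 + lform x1 * lform y2 * lform z2
            + lform x2 * lform y1 * lform z3)
    \/ (is_pullback_atmost f 8 /\ (codimv (Lspace f 2) <= 4)%N)
    \/ (is_pullback_atmost f 9 /\ (codimv (Lspace f 2) <= 3)%N) )
  /\ (codimv (Lspace f 2) <= 6)%N.
Proof.
have pullback6 : is_pullback_atmost f 6 -> (codimv (Lspace f 2) <= 6)%N.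
  exact: pullback6_bound.
have [[P1 [P2 [P1s P2s cap12]]]|nodisj] := classic (exists P1 P2,
    [/\ slice_plane f P1, slice_plane f P2 & (P1 :&: P2 = 0)%VS]); last first.
  have [|[h h0 hP]|f6] := @meeting_planes _ _ f f_cubic f_slice.
  - move=> P Q Ps Qs; apply/eqP => PQ; apply: nodisj; by exists P, Q.
  - split; last first.
      by apply: leq_trans (common_line_bound f_cubic f_slice h0 hP) _.
    (* A vector common to all slice planes is a linear form vanishing on every [L], so its kernel is
       the fixed hyperplane. *)
    left; exists (lker h); split=> [|L LX cL]; first exact: codimv_lker.
    have [P Ps PL] := slice_plane_of f_cubic f_slice LX cL.
    by apply/subvP => v vL; rewrite memv_ker (PL _ _ (hP _ Ps) vL).
  by split; [right; left|exact: pullback6].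
(* If all slice planes lie in the four-dimensional [P1 + P2], the codimension is at most 4, and the
   expression of [f] through two disjoint planes uses eight forms. *)
have [P12|nP12] := classic (forall P, slice_plane f P -> (P <= P1 + P2)%VS).
  have c4 : (codimv (Lspace f 2) <= 4)%N.
    apply: (Lspace_codim_le f_cubic f_slice (W := (P1 + P2)%VS)) => //.
    by rewrite dimv_disjoint_sum // P1s.1 P2s.1.
  split; last exact: leq_trans c4 _.
  do 3![right]; left; split=> //.
  have [[d1 f1] [d2 f2]] := (P1s, P2s).
  have [a1 [a2 [E1 fra]]] := plane_basis d1.
  have [b1 [b2 [E2 frb]]] := plane_basis d2; subst P1 P2.
  have fr := disjoint_planes_free fra frb cap12.
  have [k1 [k2 [m1 [m2 Ef]]]] := two_planes f_cubic fr f1 f2.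
  apply: (@is_pullback_span _ _ [:: a1; a2; b1; b2; k1; k2; m1; m2]) => //.
  by apply: (two_planes_lsub Ef) => x; apply: memv_span.
have {nP12} [P [Ps nP]] : exists P, slice_plane f P /\ ~~ (P <= P1 + P2)%VS.
  apply: NNPP => nex; apply: nP12 => P Ps; apply: contraT => nP.
  by case: nex; exists P.
have [f6|[v v0 [vP v12]]] := third_plane f_cubic P1s P2s Ps cap12 nP.
  by split; [right; left|exact: pullback6].
have [x1 [x2 [y1 [y2 [z1 [z2 [z3 Ef]]]]]]] : exists x1 x2 y1 y2 z1 z2 z3,
    f = lform x1 * lform y1 * lform z1 + lform x1 * lform y2 * lform z2
      + lform x2 * lform y1 * lform z3.
  case: v12; first exact: (adjacent_plane f_cubic P1s P2s Ps cap12 nP v0 vP).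
  rewrite capvC in cap12; rewrite addvC in nP.
  exact: (adjacent_plane f_cubic P2s P1s Ps cap12 nP v0 vP).
(* Pullbacks from dimension at most 6 are set aside here, because locating the slice planes of the
   normal form relies on their exclusion. *)
have [f6|nf6] := classic (is_pullback_atmost f 6).
  by split; [right; left|exact: pullback6].
have [fr|/negP nfr] := boolP (free [:: x1; x2; y1; y2; z1; z2; z3]); last first.
  by case: nf6; apply: normal_form_pullback Ef nfr.
split; first by do 2![right]; left; exists x1, x2, y1, y2, z1, z2, z3.
apply: (Lspace_codim_le f_cubic f_slice
  (* No slice plane involves [z1], so six of the seven forms are enough. *)
  (W := <<[:: x1; x2; y1; y2; z2; z3]>>%VS)); first exact: dim_span.
by move=> Q; apply: (normal_form_planes f_cubic fr Ef nf6).
Qed.
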